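(* Let $N\ge3$ be odd and let $V$ be the $F$-vector space with basis $\{e_s;s\in S\}$ described in the context, where $(S,\mathfrak{E})$ is a cycle with $N$ vertices. For $B\in\phi(V)$ let $M_B$ be the subspace of $V$ spanned by $\{e_I;I\in B\}$. Let $\mathcal{F}(V)$ (resp. $\mathcal{F}^1(V)$) be the collection of subspaces of $V$ of the form $M_B$ (resp. $M_B\oplus Fe_S$) for $B\in\phi(V)$, and let $\tilde{\mathcal{F}}(V)=\mathcal{F}(V)\sqcup\mathcal{F}^1(V)$. Define $\tilde\epsilon:\tilde{\mathcal{F}}(V)\to V$ by $\tilde\epsilon(M_B)=\epsilon(B)$, $\tilde\epsilon(M_B\oplus Fe_S)=\epsilon(B)+e_S$. Then: (1) for any $X\in\tilde{\mathcal{F}}(V)$ we have $\tilde\epsilon(X)\in X$; (2) $\tilde\epsilon:\tilde{\mathcal{F}}(V)\to V$ is a bijection; (3) the relation $X'\le X$ on $\tilde{\mathcal{F}}(V)$ defined by requiring that one of the following holds for some $B,B'\in\phi(V)$ with $B'\le B$: $X=M_B, X'=M_{B'}$; or $X=M_B\oplus Fe_S, X'=M_{B'}\oplus Fe_S$; or $X=M_B\oplus Fe_S, X'=M_{B'}$; is a partial order on $\tilde{\mathcal{F}}(V)$.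
   Context: $F=\mathbb{Z}/2$; $N\ge3$ is odd. $(S,\mathfrak{E})$ is a graph which is a cycle with $N$ vertices. $V$ is an $F$-vector space with basis $\{e_s;s\in S\}$ and symplectic (alternating bilinear) form with, for $s\ne s'$, $\langle e_s,e_{s'}\rangle=1$ if $\{s,s'\}\in\mathfrak{E}$ and $0$ otherwise. $e_I=\sum_{s\in I}e_s$ for $I\subset S$. For $I\subset S$, $\underline I$ is the full subgraph on $I$. $\mathcal{I}$ is the set of $I\subset S$ with $\underline I$ a path with $m\ge1$ vertices; $\mathcal{I}^1=\{I\in\mathcal{I};|I|\text{ odd}\}$. For $I,I'\in\mathcal{I}^1$: $I\prec I'$ means $I\subsetneq I'$ and $\underline{I'-I}$ is disconnected; $I\spadesuit I'$ means $I\cap I'=\emptyset$ and $\underline{I\cup I'}$ is disconnected. For $I\in\mathcal{I}^1$, $I^{ev}$ is the set of $s\in I$ with $I-\{s\}=I'\sqcup I''$, $I',I''\in\mathcal{I}^1$, $I'\spadesuit I''$. $R$ is the set of finite subsets of $\mathcal{I}^1$. $\phi(V)$ is the set of $B\in R$ such that: $(P_0)$ if $I,I'\in B$ then $I=I'$ or $I\spadesuit I'$ or $I\prec I'$ or $I'\prec I$; $(P_1)$ for each $I\in B$ there are pairwise disjoint $I_1,\dots,I_k\in B$ ($k\ge0$) with all $I_j\prec I$ and $I^{ev}\subset I_1\cup\dots\cup I_k$. For $B\in\phi(V)$ and $s\in S$: $g_s(B)=|\{I\in B;s\in I\}|$ and $\epsilon(B)=\sum_{s\in S}\frac12g_s(B)(g_s(B)+1)e_s\in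 V$ (coefficients mod 2). For $B',B\in\phi(V)$ write $B'\le B$ if there exist $B_0=B',B_1,\dots,B_k=B$ in $\phi(V)$ with $\epsilon(B_{i})\in M_{B_{i+1}}$ for $0\le i\le k-1$. The map $B\mapsto M_B$ is injective on $\phi(V)$ and $e_S\notin M_B$, so the definitions in the claim make sense. *)

(* Defs.v *)
From HB Require Import structures.
From mathcomp Require Import all_boot all_order all_algebra.

Set Implicit Arguments.
Unset Strict Implicit.
Unset Printing Implicit Defensive.

Import GRing.Theory.
Local Open Scope ring_scope.

(* The vector space F^S over F = Z/2. *)
Notation FSpace S := {ffun S -> ('F_2)^o}.

Definition path_graph (m : nat) : rel 'I_m :=
  fun i j => (i.+1 == j :> nat) || (j.+1 == i :> nat).

(* ordS is the successor modulo m, so this is the m-cycle for 3 <= m. *)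
Definition cycle_graph (m : nat) : rel 'I_m :=
  fun i j => (ordS i == j) || (ordS j == i).

Section Graph.

Variables (S : finType) (E : rel S).
Implicit Types (I J K : {set S}) (B C : {set {set S}}).

(* The full subgraph of (S, E) on I is isomorphic to the graph G. *)
Definition full_subgraph_iso (m : nat) (G : rel 'I_m) (I : {set S}) : bool :=
  [exists f : {ffun 'I_m -> S},
    [&& injectiveb f, [set f i | i : 'I_m] == I
      & [forall i, forall j, E (f i) (f j) == G i j]]].

Definition is_cycle (N : nat) : bool :=
  full_subgraph_iso (@cycle_graph N) [set: S].

(* Only applied to nonempty sets of vertices, so the convention for the empty
   graph is immaterial. *)
Definition disconnected (I : {set S}) : bool :=
  ~~ [forall x in I, forall y in I,
        connect [rel u v | [&& u \in I, v \in I & E u v]] x y].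

Definition intervals : {set {set S}} :=
  [set I : {set S} | (0 < #|I|)%N && full_subgraph_iso (@path_graph #|I|) I].

Definition odd_intervals : {set {set S}} :=
  [set I : {set S} in intervals | odd #|I|].

Definition prec I J : bool := (I \proper J) && disconnected (J :\: I).

Definition spade I J : bool := [disjoint I & J] && disconnected (I :|: J).

Definition ev I : {set S} :=
  [set s in I | [exists J in odd_intervals, exists K in odd_intervals,
                   spade J K && (I :\ s == J :|: K)]].

Definition P0 B : bool :=
  [forall I in B, forall J in B, [|| I == J, spade I J, prec I J | prec J I]].

(* The pairwise disjoint family I_1, ..., I_k is the set C: its members are
   nonempty, hence distinct. *)
Definition P1 B : bool :=
  [forall I in B, exists C : {set {set S}},
    [&& C \subset B, trivIset C, [forall J in C, prec J I]
      & ev I \subset cover C]].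

Definition phi : {set {set {set S}}} :=
  [set B : {set {set S}} | [&& B \subset odd_intervals, P0 B & P1 B]].

Definition basis_vect (s : S) : FSpace S := [ffun t => (t == s)%:R].

Definition char_vect I : FSpace S := \sum_(s in I) basis_vect s.

Definition M B : {vspace FSpace S} := <<[seq char_vect J | J <- enum B]>>%VS.

Definition M1 B : {vspace FSpace S} := (M B + <[char_vect [set: S]]>)%VS.

Definition mult (s : S) B : nat := #|[set I : {set S} in B | s \in I]|.

Definition epsilon B : FSpace S :=
  \sum_(s : S) ((mult s B * (mult s B).+1) %/ 2)%N%:R *: basis_vect s.

(* B' <= B on phi; connect is the reflexive transitive closure. *)
Definition le_phi (B' B : {set {set S}}) : bool :=
  [&& B' \in phi, B \in phi
    & connect [rel C' C | [&& C' \in phi, C \in phi & epsilon C' \in M C]]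
        B' B].

Definition calF : pred {vspace FSpace S} :=
  [pred X | [exists B in phi, X == M B]].

Definition calF1 : pred {vspace FSpace S} :=
  [pred X | [exists B in phi, X == M1 B]].

Definition Ftilde : Type := {X : {vspace FSpace S} | calF X || calF1 X}.

Definition le_tilde : rel Ftilde := fun X' X =>
  [exists B : {set {set S}}, exists B' : {set {set S}}, le_phi B' B &&
    [|| (val X == M B) && (val X' == M B'),
        (val X == M1 B) && (val X' == M1 B')
      | (val X == M1 B) && (val X' == M B')]].

(* The defining equations of the map from Ftilde to V; they determine it, as
   every X : Ftilde is of the form M B or M1 B. *)
Definition is_epsilon_tilde (et : Ftilde -> FSpace S) : Prop :=
  forall (X : Ftilde) (B : {set {set S}}), B \in phi ->
    (val X = M B -> et X = epsilon B) /\
    (val X = M1 B -> et X = epsilon B + char_vect [set: S]).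

End Graph.

(* Main.v *)
Require Import Defs.
From HB Require Import structures.
From mathcomp Require Import all_boot all_order all_algebra.
From mathcomp Require Import zify.

(* Each B in phi is recorded by its multiplicity function g = g_s(B) around the
   cycle. By (P_0) and (P_1) along each edge at most one member of B, the
   innermost one, is entered or left, and an edge with no such change lies
   outside all members: g is a closed walk on the naturals with steps +1, -1, or
   flat at height 0. Conversely B consists of the components of the level sets
   {g >= d}, d >= 1, of such a walk.

   Relabel the heights 0, 1, 2, 3, 4, ... by h = 0, 1, -1, 2, -2, .... The walks
   become the functions h : S -> Z with h(s) + h(s') in {0, 1} on each edge, and
   eps(B) is h mod 2. As the cycle is odd, h is determined by its sums along the
   edges, and every vector modulo e_S comes from exactly one h; so eps induces a
   bijection from phi onto V / F e_S.

   If eps(C) lies in M_B + F e_S, its h is at each vertex an alternating sum of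
   coefficients in {0, 1} along the chain of members of B through that vertex,
   and this forces g_s(C) <= g_s(B) for all s. Hence the relation on phi is
   antisymmetric, and B is determined by M_B + F e_S. *)

Set Implicit Arguments.
Unset Strict Implicit.
Unset Printing Implicit Defensive.

(** * Integer labels of heights and reduction modulo 2 *)

Section Parity.
Local Open Scope ring_scope.
Import GRing.Theory.

(* 0, 1, 2, 3, 4, ... is sent to 0, 1, -1, 2, -2, ..., so that enc m has the
   parity of the triangular number m(m+1)/2 and neighbours add up to 0 or 1. *)
Definition enc (m : nat) : int := if odd m then (m.+1)./2%:Z else - (m./2)%:Z.

Definition dec (h : int) : nat :=
  (if h is Posz n then n.*2.-1 else `|h|.*2)%N.

Lemma encK : cancel enc dec.
Proof.
move=> m; rewrite /enc; case: ifP => om; first by rewrite /=; lia.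
by case E: (m./2) => [|n]; rewrite /= ?absz_nat; lia.
Qed.

Lemma decK : cancel dec enc.
Proof.
case=> [[|n]|n]; rewrite /dec /enc //.
  by rewrite doubleS /= odd_double /=; lia.
by rewrite odd_double /=; lia.
Qed.

(** Labels with sum 0 belong to the pairs of heights {2k-1, 2k}, or to 0 taken twice; labels with
    sum 1 to the pairs {2k, 2k+1}. So height 0 is the only one that allows a flat step. *)
Lemma enc_stepP (m n : nat) :
  ((enc m + enc n == 0) || (enc m + enc n == 1)) =
  [|| (m == 0%N) && (n == 0%N), m == n.+1 | n == m.+1].
Proof. by rewrite /enc; case: ifP => om; case: ifP => on; lia. Qed.

(** The reflection h -> -h exchanges heights 2k-1 and 2k and fixes 0; the reflection h -> 1-h
    exchanges 2k and 2k+1. *)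
Lemma dec_sub_le (a : int) h : (a == 0) || (a == 1) -> (dec (a - h) <= (dec h).+1)%N.
Proof.
have decE (x : int) : (dec x)%:Z = if 0 < x then x *+ 2 - 1 else - (x *+ 2).
  by case: x => [[|n]|n]; rewrite /dec //=; lia.
have := decE h; have := decE (a - h).
by case: ifP; case: ifP => ? ? ? ? /orP[] /eqP ?; lia.
Qed.

Lemma F2_natE (n : nat) : n%:R = (odd n)%:R :> 'F_2.
Proof. by apply: val_inj; rewrite !Zp_nat /= modn2; case: (odd n). Qed.

Lemma F2_addxx (x : 'F_2) : x + x = 0.
Proof. by rewrite -mulr2n mulrn_char. Qed.

Lemma F2_opp (x : 'F_2) : - x = x.
Proof. by apply/eqP; rewrite eq_sym -addr_eq0 F2_addxx. Qed.

Lemma F2_intE (z : int) : z%:~R = (odd `|z|)%:R :> 'F_2.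
Proof. by case: z => n; rewrite ?NegzE ?mulrNz ?F2_opp -?pmulrn [LHS]F2_natE ?abszN absz_nat. Qed.

Lemma F2_natK (x : 'F_2) : (x : nat)%:R = x.
Proof. exact: natr_Zp. Qed.

Lemma F2_lt2 (x : 'F_2) : (x < 2)%N.
Proof. exact: (ltn_ord x). Qed.

(** The even one of m and m+1 absorbs the division by 2 and the other factor is odd, so only the
    parity of that half remains. *)
Lemma enc_F2 (m : nat) : (enc m)%:~R = ((m * m.+1) %/ 2)%N%:R :> 'F_2.
Proof.
rewrite F2_intE [RHS]F2_natE /enc; congr ((_ : bool)%:R).
case: ifP => om; rewrite ?abszN absz_nat.
  have -> : ((m * m.+1) %/ 2 = m * (m.+1)./2)%N by rewrite -{1}(@odd_double_half m.+1) /= om -muln2 mulnA mulnK.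
  by rewrite oddM om.
have -> : ((m * m.+1) %/ 2 = m.+1 * m./2)%N.
  by rewrite mulnC -{2}(@odd_double_half m) om -muln2 mulnA mulnK.
by rewrite oddM /= om.
Qed.

Lemma F2_int01_inj (c d : int) : (c == 0) || (c == 1) -> (d == 0) || (d == 1) ->
  c%:~R = d%:~R :> 'F_2 -> c = d.
Proof. by move=> /orP[] /eqP-> /orP[] /eqP-> // /eqP. Qed.

End Parity.

(** * Chains of sets and alternating sums along them *)

Section Chains.
Variable S : finType.
Implicit Types (I J : {set S}) (C : {set {set S}}).

(** Induction that peels off the smallest member of a chain. This matches a step along an edge of
    the cycle, which adds or removes the innermost member. *)
Lemma chain_ind (P : {set {set S}} -> Prop) :
  P set0 ->
  (forall C I, I \in C -> {in C, forall J, I \subset J} -> P (C :\ I) -> P C) ->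
  forall C, {in C &, forall I J, (I \subset J) || (J \subset I)} -> P C.
Proof.
move=> P0 PS C; have [n] := ubnP #|C|; elim: n C => // n IHn C leCn chC.
have [->//|/set0Pn[I0 I0C]] := eqVneq C set0.
have [I IC Imin] := arg_minnP (fun I : {set S} => #|I|) (I0C : (fun I => I \in C) I0).
apply: (PS C I IC) => [J JC|].
  case/orP: (chC _ _ IC JC) => // JI.
  by have /eqP-> : J == I by rewrite eqEcard JI Imin.
apply: IHn; first by move: leCn; rewrite (cardsD1 I C) IC.
by move=> J K /setD1P[_ JC] /setD1P[_ KC]; apply: chC.
Qed.

Local Open Scope ring_scope.
Import GRing.Theory.

(* For C = {I_1 < ... < I_d} this is A(I_1) - A(I_2) + A(I_3) - ... *)
Definition alt_sum (A : {set S} -> int) C : int :=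
  \sum_(I in C) (-1) ^+ #|[set J in C | J \proper I]| * A I.

Lemma alt_sum0 A : alt_sum A set0 = 0.
Proof. exact: big_set0. Qed.

(** Without its minimum, every other member has one predecessor fewer, so all remaining signs
    flip. *)
Lemma alt_sum_min A C I : I \in C -> {in C, forall J, I \subset J} ->
  alt_sum A C = A I - alt_sum A (C :\ I).
Proof.
move=> IC Imin; rewrite /alt_sum (big_setD1 I) //=; congr (_ + _).
  rewrite (_ : [set J in C | _] = set0) ?cards0 ?expr0 ?mul1r //.
  apply/setP => J; rewrite !inE; apply/negP => /andP[/Imin IJ].
  by rewrite properE IJ andbF.
rewrite -sumrN; apply: eq_bigr => J /setD1P[JI JC].
rewrite (cardsD1 I) !inE IC properEneq Imin // eq_sym JI /= add1n exprS mulN1r mulNr.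
congr (- (_ ^+ #|pred_of_set _| * _)); apply/setP => K.
by rewrite !inE andbA.
Qed.

(** Each member acts by one reflection h -> A(I) - h, which raises the height by at most one. *)
Lemma alt_sum_bound A C : (forall I, (A I == 0) || (A I == 1)) ->
  {in C &, forall I J, (I \subset J) || (J \subset I)} ->
  (dec (alt_sum A C) <= #|C|)%N.
Proof.
move=> A01; elim/chain_ind: C / => [|C I IC Imin IH]; first by rewrite alt_sum0.
rewrite (alt_sum_min _ IC Imin) (cardsD1 I) IC add1n.
by apply: leq_trans (dec_sub_le _ (A01 I)) _.
Qed.

Lemma alt_sum_F2 A C : (alt_sum A C)%:~R = \sum_(I in C) (A I)%:~R :> 'F_2.
Proof.
rewrite /alt_sum rmorph_sum; apply: eq_bigr => I _ /=.
by rewrite rmorphM rmorphXn /= rmorphN rmorph1 F2_opp expr1n mul1r.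
Qed.

(** From the smallest member upwards the counts are d, d-1, ..., 1, whose sum is the triangular
    number in the definition of [epsilon]. *)
Lemma chain_sum_above C :
  {in C &, forall I J, (I \subset J) || (J \subset I)} ->
  (\sum_(I in C) #|[set J in C | I \subset J]| = (#|C| * #|C|.+1) %/ 2)%N.
Proof.
elim/chain_ind: C / => [|C I IC Imin IH]; first by rewrite big_set0 cards0.
rewrite (big_setD1 I) //= (_ : [set J in C | I \subset J] = C); last first.
  by apply/setP => J; rewrite inE; case: (boolP (J \in C)) => // /Imin.
(* The minimum I contains no other member, so dropping it changes none of these counts. *)
have -> : (\sum_(J in C :\ I) #|[set K in C | J \subset K]| =
           \sum_(J in C :\ I) #|[set K in C :\ I | J \subset K]|)%N.
  apply: eq_bigr => J /setD1P[JI JC]; congr #|pred_of_set _|; apply/setP => K.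
  rewrite !inE; case: eqP => //= ->; rewrite IC /=.
  by apply: contraNF JI => JI; rewrite eqEsubset JI Imin.
rewrite IH (cardsD1 I C) IC add1n; set n := #|_|.
have -> : (n.+1 * n.+2 = n.+1 * 2 + n * n.+1)%N by lia.
by rewrite divnMDl.
Qed.

End Chains.

(** * The cycle as a single orbit of a rotation [sigma] of order N *)

Section CycleGraph.

Variables (S : finType) (E : rel S) (N : nat) (sigma : S -> S).
Hypothesis (N_ge3 : 2 < N) (N_odd : odd N).
Hypothesis edgeE : forall s t, E s t = (sigma s == t) || (sigma t == s).
Hypothesis sigma_inj : injective sigma.
Hypothesis sigma_trans : forall s t, exists i, t = iter i sigma s.
Hypothesis iter_sigma_eq :
  forall i j s, (iter i sigma s == iter j sigma s) = (i == j %[mod N]).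

Implicit Types (s t u v a : S) (I J K X Y : {set S}).
Implicit Types (B C : {set {set S}}) (g : S -> nat).

Notation inside X := [rel u v | [&& u \in X, v \in X & E u v]].
Notation conn X := (~~ disconnected E X).

Lemma iter_sigma_lt i j s :
  i < N -> j < N -> (iter i sigma s == iter j sigma s) = (i == j).
Proof. by move=> iN jN; rewrite iter_sigma_eq !modn_small. Qed.

Lemma iter_sigma_period s : iter N sigma s = s.
Proof. by apply/eqP; rewrite -[_ == _]/(_ == iter 0 sigma s) iter_sigma_eq modnn mod0n. Qed.

Lemma iter_sigma_bounded s t : exists2 i, i < N & t = iter i sigma s.
Proof.
have [i ->] := sigma_trans s t; exists (i %% N); first by rewrite ltn_mod; lia.
by apply/eqP; rewrite iter_sigma_eq modn_mod.
Qed.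

Lemma edge_sym u v : E u v = E v u.
Proof. by rewrite !edgeE orbC. Qed.

Lemma edge_sigma s : E s (sigma s).
Proof. by rewrite edgeE eqxx. Qed.

Lemma edgeP s t : reflect (t = sigma s \/ s = sigma t) (E s t).
Proof. by rewrite edgeE; apply: (iffP orP) => -[]; [move/eqP| move/eqP | move->; left| move->; right]; auto. Qed.

Lemma sigma_pred s : exists t, s = sigma t.
Proof.
exists (iter N.-1 sigma s); rewrite -iterS prednK ?iter_sigma_period //; lia.
Qed.

(** Follow [sigma] from s and stop just before the first vertex outside X; t guarantees that there
    is one. *)
Lemma exit_after X s t : s \in X -> t \notin X ->
  exists i, [/\ forall j, j <= i -> iter j sigma s \in X
              & sigma (iter i sigma s) \notin X].
Proof.
move=> sX; have [k ->] := sigma_trans s t => tX.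
case: (ex_minnP (ex_intro (fun k => iter k sigma s \notin X) k tX)).
move=> [|i] /= iX imin; first by rewrite sX in iX.
exists i; split=> // j ji; apply: contraT => jX.
by have := imin _ jX; lia.
Qed.

(** * Connected sets of vertices and their exits *)

Lemma connP X : reflect {in X &, forall x y, connect (inside X) x y} (conn X).
Proof.
rewrite negbK; apply: (iffP forall_inP) => [h x y xX yX|h x xX].
  by have /forall_inP := h x xX; apply.
by apply/forall_inP=> y yX; apply: h.
Qed.

(** Connectedness as an induction principle: a property that passes along the edges inside X spreads
    from one vertex to all of X. *)
Lemma conn_subset X (A : pred S) x : conn X -> x \in X -> A x ->
  (forall u v, u \in X -> v \in X -> A u -> E u v -> A v) ->
  forall y, y \in X -> A y.
Proof.
move=> /connP cX xX Ax clos y yX; have /connectP[p] := cX _ _ xX yX.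
elim: p x xX Ax {cX} => [|z p IHp] x xX Ax /=; first by move=> _ ->.
by move=> /andP[/and3P[_ zX xz]] /IHp; apply=> //; apply: clos Ax xz.
Qed.

(** The vertices that reach z1 by forward steps inside X are closed under the edges of X, so z2 is
    among them; but no forward step inside X leaves z2. *)
Lemma conn_exit_unique X z1 z2 : conn X ->
  z1 \in X -> sigma z1 \notin X -> z2 \in X -> sigma z2 \notin X -> z1 = z2.
Proof.
move=> cX z1X z1n z2X z2n.
pose D := [rel u v | (sigma u == v) && (v \in X)].
have /connectP[[|w p] /=] : connect D z2 z1; last by move=> /andP[/andP[/eqP<-]]; rewrite (negPf z2n).
  apply: (@conn_subset X (fun u => connect D u z1) z1) => // u v uX vX.
  move=> /connectP[[|w p] /= pP lP] /edgeP[vE|uE].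
  - by move: vX; rewrite vE -lP (negPf z1n).
  - by apply: connect1; rewrite /= -uE lP eqxx.
  - by apply/connectP; exists p; case/andP: pP => /andP[/eqP wE _]; rewrite vE wE.
  - apply: (@connect_trans _ _ u); last by apply/connectP; exists (w :: p).
    by apply: connect1; rewrite /= -uE eqxx.
by move=> _ ->.
Qed.

Lemma connect_inside_sym X : connect_sym (inside X).
Proof.
apply: sym_connect_sym => x y /=.
by rewrite edge_sym !andbA [(x \in X) && _]andbC.
Qed.

Lemma connect_iter X s i : (forall j, j <= i -> iter j sigma s \in X) ->
  connect (inside X) s (iter i sigma s).
Proof.
elim: i => [|i IHi] h; first exact: connect0.
apply: connect_trans (IHi _) (connect1 _) => [j ji|]; first by apply: h; lia.
by rewrite /= edge_sigma (h i) // (h i.+1).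
Qed.

(** Running forward, every vertex of X arrives at an exit, and the only one is e. *)
Lemma exit_unique_conn X e t : t \notin X ->
  (forall z, z \in X -> sigma z \notin X -> z = e) -> conn X.
Proof.
move=> tX eP; have toe x : x \in X -> connect (inside X) x e.
  move=> xX; have [i [h1 h2]] := exit_after xX tX.
  by rewrite -(eP _ (h1 i (leqnn i)) h2); apply: connect_iter.
apply/connP => x y xX yX; apply: connect_trans (toe x xX) _.
by rewrite connect_inside_sym toe.
Qed.

(** * Arcs, and odd intervals as proper arcs of odd length *)

Definition arc s m : {set S} := [set iter i sigma s | i : 'I_m].

Lemma arcP s m t : reflect (exists2 i, i < m & t = iter i sigma s) (t \in arc s m).
Proof.
apply: (iffP imsetP) => [[i _ ->]|[i im ->]]; first by exists i.
by exists (Ordinal im).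
Qed.

Lemma mem_arc_first s m : 0 < m -> s \in arc s m.
Proof. by move=> m0; apply/arcP; exists 0. Qed.

Lemma mem_arc s m i : m <= N -> i < N -> (iter i sigma s \in arc s m) = (i < m).
Proof.
move=> mN iN; apply/arcP/idP => [[j jm /eqP]|im]; last by exists i.
by rewrite iter_sigma_lt //; [move/eqP->|lia].
Qed.

Lemma card_arc s m : m <= N -> #|arc s m| = m.
Proof.
move=> mN; rewrite card_imset ?card_ord // => i j /eqP.
by rewrite iter_sigma_lt => [/eqP/val_inj||] //; apply: leq_trans (ltn_ord _) mN.
Qed.

Lemma conn_arc s m : m < N -> conn (arc s m).
Proof.
move=> mN; apply/connP => x y.
suff h z : z \in arc s m -> connect (inside (arc s m)) s z.
  by move=> /h xs /h; apply: connect_trans; rewrite connect_inside_sym.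
move=> /arcP[i im ->]; apply: connect_iter => j ji.
by rewrite mem_arc; lia.
Qed.

(** Start right after a vertex q outside X whose successor lies in X, and run forward up to the
    first exit. *)
Lemma conn_proper_arc X s t : conn X -> s \in X -> t \notin X ->
  exists a m, [/\ 0 < m, m < N & X = arc a m].
Proof.
move=> cX sX tX.
have [i] : exists i, [/\ forall j, j <= i -> iter j sigma t \in ~: X
              & sigma (iter i sigma t) \notin ~: X].
  by apply: (@exit_after _ _ s); rewrite !inE ?sX.
case=> /(_ i (leqnn i)); rewrite !inE negbK.
set q := iter i sigma t => qX aX; pose a := sigma q.
have [m [mX mn]] := exit_after aX qX.
(* A run of N vertices starting after q would contain q itself. *)
have mN : m.+1 < N.
  rewrite ltnNge; apply/negP => Nm; have := mX N.-1; case: {mX} N Nm N_ge3 (iter_sigma_period q) => // n nm _.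
  by rewrite iterSr => -> h; move: qX; rewrite h.
exists a, m.+1; split=> //; apply/eqP; rewrite eqEsubset; apply/andP; split; last first.
  by apply/subsetP => _ /arcP[j jm ->]; apply: mX.
apply/subsetP; apply: (conn_subset cX aX); first by apply/arcP; exists 0.
move=> u v uX vX /arcP[j jm uE] /edgeP[vE|uv].
- apply/arcP; exists j.+1; last by rewrite vE uE.
  rewrite ltnS ltn_neqAle -ltnS jm andbT; apply: contraNneq mn => <-.
  by rewrite -uE -vE.
- case: j jm uE => [|j] jm uE.
    by move: vX; rewrite -(sigma_inj (etrans (esym uE) uv)) (negPf qX).
  by apply/arcP; exists j; [lia|apply: sigma_inj; rewrite -uv uE].
Qed.

Lemma odd_intervals_arc a m : odd m -> m < N -> arc a m \in odd_intervals E.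
Proof.
move=> om mN; rewrite !inE card_arc ?(ltnW mN) // om andbT.
apply/andP; split; first by case: m om {mN}.
apply/existsP; exists [ffun i : 'I_m => iter i sigma a]; apply/and3P; split.
- apply/injectiveP => i j; rewrite !ffunE => /eqP.
  by rewrite iter_sigma_lt => [/eqP/val_inj||] //; apply: ltn_trans (ltn_ord _) mN.
- by apply/eqP/eq_imset => i; rewrite ffunE.
- apply/forallP => i; apply/forallP => j; rewrite !ffunE edgeE /path_graph.
  have iN := ltn_ord i; have jN := ltn_ord j.
  by rewrite -!iterS !iter_sigma_lt //; lia.
Qed.

Lemma odd_intervals_conn I : I \in odd_intervals E ->
  [/\ conn I, exists s, s \in I, exists t, t \notin I & odd #|I|].
Proof.
rewrite !inE => /andP[/andP[I0 /existsP[f /and3P[/injectiveP fi /eqP fI /forallP fE]]] oI].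
have {}fE i j : E (f i) (f j) = path_graph i j by have /forallP/(_ j)/eqP := fE i.
have fIn i : f i \in I by move/setP/(_ (f i)): fI => <-; rewrite imset_f.
have inI x : x \in I -> exists i, x = f i.
  by move/setP/(_ x): fI => <- /imsetP[i _ ->]; exists i.
pose i0 := Ordinal I0.
have toI x : x \in I -> connect (inside I) (f i0) x.
  move=> /inI[[i iI] ->]; elim: i iI => [|i IHi] iI.
    by rewrite (_ : Ordinal iI = i0) ?connect0 //; apply: val_inj.
  apply: connect_trans (IHi (ltnW iI)) (connect1 _).
  by rewrite /= !fIn fE /path_graph /= eqxx.
split=> //.
- apply/connP => x y /toI x0 /toI; apply: connect_trans.
  by rewrite connect_inside_sym.
- by exists (f i0).
(* If I were the whole cycle, the first vertex of the path would have its predecessor and its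
   successor as neighbours, distinct as N >= 3; but the end of a path has at most one neighbour. *)
- case: (pickP (fun t => t \notin I)) => [t tI|allI]; first by exists t.
  have {}inI t : exists i, t = f i by apply: inI; have := allI t => /negbFE.
  have [p pE] := sigma_pred (f i0).
  have [i iE] := inI (sigma (f i0)); have [j jE] := inI p.
  have := fE i0 i; have := fE i0 j; rewrite -iE -jE edge_sigma edge_sym pE edge_sigma.
  rewrite /path_graph /= !orbF => /esym/eqP j1 /esym/eqP i1.
  have ij : i = j by apply: val_inj; rewrite /= -i1 -j1.
  have := iter_sigma_lt (i := 2) (j := 0) p N_ge3 (ltnW (ltnW N_ge3)).
  by rewrite /= -pE iE jE ij eqxx.
Qed.

Lemma odd_intervals_arcE I : I \in odd_intervals E ->
  exists a m, [/\ odd m, m < N & I = arc a m].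
Proof.
move=> /odd_intervals_conn[cI [s sI] [t tI]] oI.
have [a [m [m0 mN IE]]] := conn_proper_arc cI sI tI.
by exists a, m; split=> //; rewrite -(card_arc a (ltnW mN)) -IE.
Qed.

(** * Separated intervals, the sets I^ev, and ends of nested intervals *)

Lemma no_edge_disconnected X Y x y : x \in X -> y \in Y -> [disjoint X & Y] ->
  (forall u v, u \in X -> v \in Y -> ~~ E u v) -> disconnected E (X :|: Y).
Proof.
move=> xX yY dXY nE; apply: contraT => cXY.
suff : y \in X by rewrite (disjointFl dXY).
apply: (@conn_subset (X :|: Y) (mem X) x cXY); rewrite ?inE ?xX ?yY ?orbT //.
move=> u v _; rewrite !inE => /orP[//|vY] uX.
by rewrite (negPf (nE u v uX vY)).
Qed.

Lemma spade_no_edge I J u v : conn I -> conn J -> spade E I J ->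
  u \in I -> v \in J -> ~~ E u v.
Proof.
move=> /connP cI /connP cJ /andP[dIJ dis] uI vJ; apply: contraL dis => uv.
have mono X Y : X \subset Y -> forall x y, connect (inside X) x y -> connect (inside Y) x y.
  move=> XY; apply: connect_sub => x y /and3P[xX yX xy].
  by apply: connect1; rewrite /= !(subsetP XY) // xy.
have tou x : x \in I :|: J -> connect (inside (I :|: J)) u x.
  rewrite inE => /orP[xI|xJ]; first by apply: mono (cI u x uI xI); apply: subsetUl.
  apply: connect_trans (mono _ _ (subsetUr I J) _ _ (cJ v x vJ xJ)).
  by apply: connect1; rewrite /= !inE uI vJ uv orbT.
apply/connP => x y /tou x0 /tou; apply: connect_trans.
by rewrite connect_inside_sym.
Qed.

Lemma arc_split a m j s : j < m -> m < N ->
  (s \in arc a m :\ iter j sigma a) =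
    (s \in arc a j :|: arc (iter j.+1 sigma a) (m - j.+1)).
Proof.
move=> jm mN; rewrite !inE; have [i iN ->] := iter_sigma_bounded a s.
rewrite !mem_arc ?iter_sigma_lt //; try lia.
case: (ltnP j i) => ji.
  have -> : iter i sigma a = iter (i - j.+1) sigma (iter j.+1 sigma a) by rewrite -iterD subnK.
  rewrite mem_arc; lia.
suff /negPf-> : iter i sigma a \notin arc (iter j.+1 sigma a) (m - j.+1) by lia.
apply/arcP => -[k km] /eqP; rewrite -iterD iter_sigma_lt //; lia.
Qed.

(** Deleting position j, counted from 0, leaves arcs with j and m-j-1 vertices, both odd. *)
Lemma ev_arc a m j : odd m -> m < N -> odd j -> j < m ->
  iter j sigma a \in ev E (arc a m).
Proof.
move=> om mN oj jm; rewrite inE mem_arc ?jm /=; try lia.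
pose s := iter j sigma a; pose J := arc a j; pose K := arc (iter j.+1 sigma a) (m - j.+1).
have splitE : arc a m :\ s = J :|: K by apply/setP => t; apply: arc_split.
apply/exists_inP; exists J; first by apply: odd_intervals_arc; lia.
apply/exists_inP; exists K; first by apply: odd_intervals_arc; lia.
rewrite splitE eqxx andbT; apply/andP; split.
  apply/pred0Pn => -[_ /andP[/arcP[i ij ->] /arcP[k km /eqP]]].
  by rewrite -iterD iter_sigma_lt; lia.
(* A connected union would have two exits, the positions j-1 and m-1. *)
apply: contraT => cJK; rewrite -splitE in cJK.
have /eqP : iter j.-1 sigma a = iter m.-1 sigma a.
  apply: (conn_exit_unique cJK); rewrite -?iterS ?prednK; try lia;
  by rewrite !inE /s ?mem_arc ?iter_sigma_lt //; lia.
rewrite iter_sigma_lt; lia.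
Qed.

(** The part that contains the first vertex a consists of exactly the i vertices before the deleted
    one, and its size is odd. *)
Lemma ev_arc_odd a m i : m < N -> i < m -> iter i sigma a \in ev E (arc a m) -> odd i.
Proof.
move=> mN im; rewrite inE => /andP[_ /exists_inP[J oJ /exists_inP[K oK /andP[sp /eqP IE]]]].
set s := iter i sigma a in IE.
wlog aJ : J K oJ oK sp IE / a \in J => [hwlog|].
  have : (a \in J :|: K) || (a == s).
    by rewrite -IE !inE orbC; case: eqP => //= _; apply: mem_arc_first; lia.
  rewrite inE -orbA => /or3P[|aK|/eqP as0].
  - by apply: hwlog sp IE.
  - apply: hwlog oK oJ _ _ aK; last by rewrite setUC.
    by rewrite /spade disjoint_sym setUC.
  (* Deleting the first vertex leaves a connected arc, so its two parts cannot be separated. *)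
  - have i0 : i = 0.
      by apply/eqP; rewrite -(iter_sigma_lt a) -/s -?as0 //; lia.
    case/andP: sp => _; rewrite -IE -as0 => {hwlog as0 IE s}.
    suff -> : arc a m :\ a = arc (sigma a) m.-1 by rewrite (negPf (conn_arc _ _)) //; lia.
    apply/setP => t; rewrite -{2}[a]/(iter 0 sigma a) arc_split; try lia.
    rewrite inE subn1; suff -> : (t \in arc a 0) = false by [].
    by apply/arcP => -[].
have [cJ _ _ odJ] := odd_intervals_conn oJ; have [cK _ _ _] := odd_intervals_conn oK.
have iN : i < N by lia.
have IEs t : (t \in arc a m :\ s) = (t \in J :|: K) by rewrite IE.
suff JE : J = arc a i by rewrite JE card_arc ?(ltnW iN) in odJ.
have i0 : 0 < i.
  rewrite lt0n; apply/eqP => i0; have := IEs a.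
  by rewrite !inE aJ /s i0 /= eqxx.
have sJ : s \notin J by have := IEs s; rewrite !inE eqxx /= => /esym/negbT/norP[].
apply/eqP; rewrite eqEsubset; apply/andP; split; apply/subsetP.
- apply: (@conn_subset J (mem (arc a i)) a cJ aJ); first by apply: mem_arc_first.
  move=> u v uJ vJ /arcP[j ji uE] /edgeP[vE|uv].
    apply/arcP; exists j.+1; last by rewrite vE uE.
    rewrite ltn_neqAle ji andbT; apply: contraNneq sJ => ji1.
    by rewrite /s -ji1 /= -uE -vE.
  case: j ji uE => [|j] ji uE; last first.
    by apply/arcP; exists j; [apply: ltnW|apply: sigma_inj; rewrite -uv uE].
  have : v \in arc a m by have := IEs v; rewrite !inE vJ => /andP[].
  move=> /arcP[k km vE]; have := iter_sigma_eq k.+1 0 a.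
  by rewrite iterS -vE -uv uE eqxx !modn_small ?(leq_ltn_trans km) ?(ltn_trans i0).
- apply: (@conn_subset (arc a i) (mem J) a (conn_arc _ iN)) => //.
    by apply: mem_arc_first.
  move=> u v _ /arcP[j ji vE] uJ uv; have := IEs v.
  have jN := ltn_trans ji iN.
  rewrite !inE vE mem_arc ?iter_sigma_lt ?(ltnW mN) // (ltn_trans ji im) (ltn_eqF ji).
  by rewrite -vE (contraTF (spade_no_edge cJ cK sp uJ)) ?uv ?orbF // => <-.
Qed.

(** Here [b] is the last vertex of the arc X and [a] is the vertex just before its first one. *)
Lemma conn_boundary X s t : conn X -> s \in X -> t \notin X ->
  exists a b, [/\ b \in X, sigma b \notin X, a \notin X & sigma a \in X] /\
    (forall z, z \in X -> sigma z \notin X -> z = b) /\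
    (forall z, z \notin X -> sigma z \in X -> z = a).
Proof.
move=> cX sX tX; have [i [h1 h2]] := exit_after sX tX.
have [j []] : exists j, [/\ forall k, k <= j -> iter k sigma t \in ~: X
              & sigma (iter j sigma t) \notin ~: X].
  by apply: (@exit_after _ _ s); rewrite !inE ?sX.
move/(_ j (leqnn j)); rewrite !inE negbK => a1 a2.
exists (iter j sigma t), (iter i sigma s); split; first by split=> //; apply: h1.
split=> z z1 z2; first exact: (conn_exit_unique cX z1 z2 (h1 i (leqnn i)) h2).
have [a [m [m0 mN XE]]] := conn_proper_arc cX sX tX.
suff h y : y \notin X -> sigma y \in X -> sigma y = a.
  by apply: sigma_inj; rewrite (h z) // (h (iter j sigma t)).
rewrite XE => yn /arcP[[|k] km] // /sigma_inj yE.
by case/arcP: yn; exists k => //; apply: ltnW.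
Qed.

(** If K contained an end of I, then I - K would have a single exit and be connected, against
    [prec]. *)
Lemma prec_boundary I K s t : I \in odd_intervals E -> K \in odd_intervals E ->
  prec E K I -> s \in I -> t \notin I -> E s t -> s \notin K.
Proof.
move=> oI oK /andP[/proper_sub/subsetP KI dis] sI tI st; apply: contraL dis => sK.
have [cI _ _ _] := odd_intervals_conn oI; have [cK _ _ _] := odd_intervals_conn oK.
have tK : t \notin K by apply: contra tI; apply: KI.
have sD : s \notin I :\: K by rewrite inE sK.
have [a [b [[bI sbI aI saI] [bU _]]]] := conn_boundary cI sI tI.
have [a' [b' [[_ _ aK saK] [_ aU']]]] := conn_boundary cK sK tK.
have dE z : (z \in I :\: K) && (sigma z \notin I :\: K) ->
    [/\ z \in I, z \notin K & sigma z \in K \/ sigma z \notin I].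
  rewrite !inE negb_and negbK => /andP[/andP[-> ->]] /orP[] ?; split=> //; auto.
case/edgeP: st => [tE|sE].
- rewrite tE in tI tK.
  (* K and I end together; I - K can be left only into the start of K. *)
  apply: (@exit_unique_conn _ a' s) => // z zD szD.
  have [zI zK [/aU'|szI]] := dE z (introT andP (conj zD szD)); first exact.
  by move: zK; rewrite (bU z zI szI) -(bU s sI tI) sK.
- apply: (@exit_unique_conn _ b s) => // z zD szD.
  have [zI zK [szK|]] := dE z (introT andP (conj zD szD)); last exact: bU.
  rewrite sE in sK; move: zI; rewrite (aU' z zK szK) -(aU' t tK sK).
  by rewrite (negPf tI).
Qed.

(** Neighbours in an arc have positions of opposite parity, and the odd positions lie in I^ev. *)
Lemma edge_ev I s t : I \in odd_intervals E -> s \in I -> t \in I -> E s t ->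
  (s \in ev E I) || (t \in ev E I).
Proof.
move=> oI sI tI st; wlog tE : s t sI tI {st} / t = sigma s.
  case/edgeP: st => [tE|sE] h; first exact: h.
  by rewrite orbC; apply: h.
have [a [m [om mN IE]]] := odd_intervals_arcE oI; rewrite IE in sI tI *.
case/arcP: sI tE tI => i im -> ->; rewrite -iterS => tI.
have im1 : i.+1 < m by move: tI; rewrite mem_arc // ?(ltnW mN) // (leq_ltn_trans im).
case oi: (odd i); first by rewrite ev_arc.
by rewrite orbC ev_arc //= oi.
Qed.

(** * How the members through a vertex change along an edge *)

Definition above B s : {set {set S}} := [set I in B | s \in I].

Lemma mem_above B s I : (I \in above B s) = (I \in B) && (s \in I).
Proof. by rewrite inE. Qed.

Section Laminar.

Variable B : {set {set S}}.
Hypothesis phiB : B \in phi E.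

Lemma phi_odd I : I \in B -> I \in odd_intervals E.
Proof. by move: phiB; rewrite inE => /and3P[/subsetP BI _ _]; apply: BI. Qed.

Lemma phi_P0 I J : I \in B -> J \in B -> [|| I == J, spade E I J, prec E I J | prec E J I].
Proof. by move: phiB; rewrite inE => /and3P[_ /forall_inP h _] /h/forall_inP; apply. Qed.

Lemma phi_cover I s : I \in B -> s \in ev E I -> exists J, [/\ J \in B, prec E J I & s \in J].
Proof.
move: phiB; rewrite inE => /and3P[_ _ /forall_inP h] /h/existsP[C].
move=> /and4P[/subsetP CB _ /forall_inP CI /subsetP IC] /IC/bigcupP[J JC sJ].
by exists J; split=> //; [apply: CB|apply: CI].
Qed.

Lemma phi_meet I J s : I \in B -> J \in B -> s \in I -> s \in J ->
  [|| I == J, prec E I J | prec E J I].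
Proof.
move=> IB JB sI sJ; have := phi_P0 IB JB; rewrite /spade.
by case: (boolP [disjoint I & J]) => //; rewrite disjoint_subset => /subsetP/(_ s sI); rewrite inE sJ.
Qed.

Lemma phi_above_sub I s t : I \in B -> s \in I -> t \notin I -> E s t ->
  above B t \subset above B s :\ I.
Proof.
move=> IB sI tI st; apply/subsetP => K; rewrite !inE => /andP[KB tK].
have KI : K != I by apply: contraNneq tI => <-.
rewrite KI KB /=; apply: contraT => sK.
have [cI _ _ _] := odd_intervals_conn (phi_odd IB).
have [cK _ _ _] := odd_intervals_conn (phi_odd KB).
have /or4P[/eqP IK|sp|/andP[/proper_sub/subsetP IK _]|/andP[/proper_sub/subsetP IK _]] := phi_P0 IB KB.
- by rewrite IK eqxx in KI.
- by have := spade_no_edge cI cK sp sI tK; rewrite st.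
- by rewrite IK in sK.
- by rewrite IK in tI.
Qed.

(** A smaller member through s would contain an end of I, which [prec_boundary] excludes; a larger
    one still contains t, since I avoids its ends. *)
Lemma phi_step I s t : I \in B -> s \in I -> t \notin I -> E s t ->
  above B t = above B s :\ I /\ forall J, J \in above B s -> I \subset J.
Proof.
move=> IB sI tI st; have sub := phi_above_sub IB sI tI st.
have below J : J \in B -> s \in J -> J != I -> t \in J /\ I \subset J.
  move=> JB sJ JI.
  have /or3P[/eqP IJ|IJ|JI'] := phi_meet IB JB sI sJ; first by rewrite IJ eqxx in JI.
  - split; last by case/andP: IJ => /proper_sub.
    apply: contraLR sI => tJ; exact: (prec_boundary (phi_odd JB) (phi_odd IB) IJ sJ tJ st).
  - by have := prec_boundary (phi_odd IB) (phi_odd JB) JI' sI tI st; rewrite sJ.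
split.
  apply/eqP; rewrite eqEsubset sub; apply/subsetP => J; rewrite !inE => /and3P[JI JB sJ].
  by rewrite JB; have [] := below J JB sJ JI.
move=> J; rewrite inE => /andP[JB sJ]; have [->//|JI] := eqVneq J I.
by have [] := below J JB sJ JI.
Qed.

(** Otherwise the smallest member I through s contains both ends of the edge. One of them lies in
    I^ev, and (P_1) covers it by a strictly smaller member, which passes through s as well. *)
Lemma phi_flat s t : E s t -> above B s = above B t -> above B s = set0.
Proof.
move=> st eqst; apply/eqP; apply: contraT => /set0Pn[I0 I0s].
have [I Is Imin] := arg_minnP (fun I : {set S} => #|I|) (I0s : (fun I => I \in above B s) I0).
move: (Is); rewrite mem_above => /andP[IB sI].
have tI : t \in I by move: Is; rewrite eqst inE => /andP[].
have [r [rI rev]] : exists r, above B r = above B s /\ r \in ev E I.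
  by case/orP: (edge_ev (phi_odd IB) sI tI st) => h; [exists s | exists t].
have [J [JB /andP[/proper_card JI _] rJ]] := phi_cover IB rev.
have := Imin J; by rewrite -rI inE JB rJ => /(_ isT); rewrite leqNgt JI.
Qed.

Lemma phi_step_cases s t : E s t ->
  [\/ above B s = set0 /\ above B t = set0,
      exists I, [/\ I \in above B s, above B t = above B s :\ I & forall J, J \in above B s -> I \subset J]
    | exists I, [/\ I \in above B t, above B s = above B t :\ I & forall J, J \in above B t -> I \subset J]].
Proof.
move=> st; have ts : E t s by rewrite edge_sym.
case: (pickP (fun I => (I \in above B s) && (t \notin I))) => [I /andP[]|nos].
  rewrite inE => /andP[IB sI] tI; have [h1 h2] := phi_step IB sI tI st.
  by constructor 2; exists I; split=> //; rewrite inE IB.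
case: (pickP (fun I => (I \in above B t) && (s \notin I))) => [I /andP[]|not].
  rewrite inE => /andP[IB tI] sI; have [h1 h2] := phi_step IB tI sI ts.
  by constructor 3; exists I; split=> //; rewrite inE IB.
have eqst : above B s = above B t.
  apply/setP => I; have := nos I; have := not I; rewrite !inE.
  by case: (I \in B) (s \in I) (t \in I) => [] [] [].
by constructor 1; rewrite -eqst (phi_flat st eqst).
Qed.

End Laminar.

(** * Level sets, closed walks, and recovery of B from its multiplicities *)

(** X is a connected component of {g >= d}, or empty; this is why a vertex of X is asked for later
    on. *)
Definition level g (d : nat) X :=
  [/\ conn X, forall x, x \in X -> d <= g x
    & forall u v, u \in X -> v \notin X -> E u v -> g v < d].

Lemma level_sub g d d' X Y s : d <= d' -> level g d X -> level g d' Y ->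
  s \in X -> s \in Y -> Y \subset X.
Proof.
move=> dd' [_ _ Xout] [cY Yge _] sX sY; apply/subsetP.
apply: (@conn_subset Y (mem X) s cY sY sX) => u v uY vY uX uv.
apply: contraT => vX; have := Xout u v uX vX uv.
by rewrite ltnNge (leq_trans dd' (Yge v vY)).
Qed.

Lemma level_unique g d X Y s : level g d X -> level g d Y ->
  s \in X -> s \in Y -> X = Y.
Proof.
move=> lX lY sX sY; apply/eqP; rewrite eqEsubset.
by rewrite (level_sub (leqnn d) lY lX sY sX) (level_sub (leqnn d) lX lY sX sY).
Qed.

(* The steps of a closed Motzkin path whose flat steps all lie on the axis *)
Definition walk g := forall s,
  [|| (g s == 0) && (g (sigma s) == 0), g s == (g (sigma s)).+1
    | g (sigma s) == (g s).+1].

(** A walk that avoids height 0 changes parity at every step and cannot close up after an odd number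
    N of steps. *)
Lemma walk_zero g s : walk g -> exists t, g t = 0.
Proof.
move=> wg; case: (pickP (fun s => g s == 0)) => [t /eqP|g0]; first by exists t.
have step t : odd (g (sigma t)) = ~~ odd (g t).
  by have := wg t; rewrite g0 /= => /orP[]/eqP->; rewrite /= ?negbK.
have par t i : odd (g (iter i sigma t)) = odd i (+) odd (g t).
  by elim: i => //= i IHi; rewrite step IHi addNb.
have := par s N; rewrite iter_sigma_period N_odd; by case: (odd _).
Qed.

Section LaminarMult.

Variable B : {set {set S}}.
Hypothesis phiB : B \in phi E.

Local Notation m := (fun s => mult s B).

Lemma multE s : mult s B = #|above B s|.
Proof. by []. Qed.

Lemma phi_walk : walk m.
Proof.
move=> s; rewrite !multE.
have [[-> ->]|[I [Is -> _]]|[I [It -> _]]] := phi_step_cases phiB (edge_sigma s).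
- by rewrite cards0.
- by rewrite (cardsD1 I (above B s)) Is eqxx orbT.
- by rewrite (cardsD1 I (above B (sigma s))) It eqxx !orbT.
Qed.

Lemma above_chain s : {in above B s &, forall I J, (I \subset J) || (J \subset I)}.
Proof.
move=> I J; rewrite !mem_above => /andP[IB sI] /andP[JB sJ].
by case/or3P: (phi_meet phiB IB JB sI sJ) => [/eqP->|/andP[/proper_sub->]|/andP[/proper_sub->]] //; rewrite ?subxx ?orbT.
Qed.

(** All members through s contain I, so the multiplicity is at least that of s throughout I; a step
    out of I loses I itself. *)
Lemma phi_level I s : I \in above B s -> {in above B s, forall J, I \subset J} ->
  level m (mult s B) I.
Proof.
rewrite mem_above => /andP[IB sI] Imin.
have ge x : x \in I -> above B s \subset above B x.
  move=> xI; apply/subsetP => J Js; have /subsetP/(_ x xI) := Imin J Js.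
  by move: Js; rewrite !mem_above => /andP[-> _].
split; first by have [] := odd_intervals_conn (phi_odd phiB IB).
  by move=> x /ge/subset_leq_card.
move=> u v uI vI uv; have [vE umin] := phi_step phiB IB uI vI uv.
have Iu : I \in above B u by rewrite mem_above IB.
have -> : mult s B = mult u B.
  apply/eqP; rewrite eqn_leq (subset_leq_card (ge u uI)); apply: subset_leq_card.
  apply/subsetP => J Ju; have /subsetP/(_ s sI) := umin J Ju.
  by move: Ju; rewrite !mem_above => /andP[-> _].
by rewrite !multE vE (cardsD1 I (above B u)) Iu.
Qed.

End LaminarMult.

(** Where I is left the multiplicity drops, so a member J of C is left there too. Both are the
    component of the same level set through the same vertex. *)
Lemma mult_subset B C : B \in phi E -> C \in phi E ->
  (forall s, mult s B = mult s C) -> B \subset C.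
Proof.
move=> phiB phiC eqm; apply/subsetP => I IB.
have [cI [s0 s0I] [t0 t0I] _] := odd_intervals_conn (phi_odd phiB IB).
have [i [h sI]] := exit_after s0I t0I; move: {h}(h i (leqnn i)) sI.
set s := iter i sigma s0 => sI tI.
have [tE Imin] := phi_step phiB IB sI tI (edge_sigma s).
have Is : I \in above B s by rewrite mem_above IB.
have lI := phi_level phiB Is Imin.
have lt : mult s B = (mult (sigma s) B).+1.
  by rewrite !multE tE (cardsD1 I (above B s)) Is.
have [[sE _]|[J [Js _ Jmin]]|[J [Jt sE _]]] := phi_step_cases phiC (edge_sigma s).
- by move: lt; rewrite eqm multE sE cards0.
- have [JC sJ] : J \in C /\ s \in J by apply/andP; rewrite -mem_above.
  have lJ := phi_level phiC Js Jmin.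
  suff -> : I = J by [].
  apply: (level_unique lI _ sI sJ); rewrite eqm.
  by case: lJ => cJ Jge Jlt; split=> // [x|u v] *; rewrite eqm; eauto.
- move: lt; rewrite !eqm !multE sE (cardsD1 J (above C (sigma s))) Jt.
  by move/eqP; rewrite add1n -[X in X == _]addn0 -addn2 eqn_add2l.
Qed.

Lemma mult_inj B C : B \in phi E -> C \in phi E ->
  (forall s, mult s B = mult s C) -> B = C.
Proof.
by move=> *; apply/eqP; rewrite eqEsubset !mult_subset.
Qed.

(** * Half-walks, coordinates of [epsilon], and the spaces M_B *)

Local Open Scope ring_scope.
Import GRing.Theory.

(** The condition [walk] after relabelling the heights by [enc]. *)
Definition half_walk (h : S -> int) := forall s,
  (h s + h (sigma s) == 0) || (h s + h (sigma s) == 1).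

(* The difference h - h' is alternating, hence zero on an odd cycle. *)
Lemma half_walk_unique h h' : half_walk h -> half_walk h' ->
  (forall s, (h s + h (sigma s))%:~R = (h' s + h' (sigma s))%:~R :> 'F_2) ->
  forall s, h s = h' s.
Proof.
move=> wh wh' eqF s; have eqh t := F2_int01_inj (wh t) (wh' t) (eqF t).
have alt t i : h (iter i sigma t) - h' (iter i sigma t) = (-1) ^+ odd i * (h t - h' t).
  elim: i => [|i IHi] /=; first by rewrite expr0 mul1r.
  by have := eqh (iter i sigma t); rewrite signrN mulNr -IHi; lia.
by have := alt s N; rewrite iter_sigma_period N_odd expr1; lia.
Qed.

Lemma char_vectE I s : char_vect I s = (s \in I)%:R.
Proof.
rewrite /char_vect sum_ffunE; case: (boolP (s \in I)) => sI.
  rewrite (bigD1 s) //= ffunE eqxx big1 ?addr0 // => t /andP[_ ts].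
  by rewrite ffunE eq_sym (negPf ts).
rewrite big1 // => t tI; rewrite ffunE; case: eqP => // st.
by rewrite st tI in sI.
Qed.

Lemma epsilonE B s : epsilon B s = ((mult s B * (mult s B).+1) %/ 2)%N%:R.
Proof.
rewrite /epsilon sum_ffunE (bigD1 s) //= !ffunE eqxx big1 ?addr0 => [|t ts].
  exact: mulr1.
by rewrite !ffunE eq_sym (negPf ts) scaler0.
Qed.

Lemma memMP B x :
  reflect (exists a : {set S} -> 'F_2, x = \sum_(I in B) a I *: char_vect I)
    (x \in M B).
Proof.
rewrite /M span_def big_map big_enum /=; apply: (iffP memv_sumP) => [[v vP ->]|[a ->]].
  have /fin_all_exists[a aE] I : exists a : 'F_2, I \in B -> v I = a *: char_vect I.
    case: (boolP (I \in B)) => [IB|_]; last by exists 0.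
    by have /vlineP[k ->] := vP I IB; exists k.
  by exists a; apply: eq_bigr => I IB; rewrite aE.
by exists (fun I => a I *: char_vect I) => // I IB; apply: memvZ; apply: memv_line.
Qed.

Lemma sum_char_vectE (a : {set S} -> 'F_2) B s :
  (\sum_(I in B) a I *: char_vect I) s = \sum_(I in above B s) a I.
Proof.
rewrite sum_ffunE big_mkcond [RHS]big_mkcond; apply: eq_bigr => I _ /=.
rewrite mem_above ffunE char_vectE; case: (I \in B) => //=.
by case: (s \in I); [apply: mulr1 | apply: mulr0].
Qed.

Lemma memM1P B x :
  reflect (exists2 y, y \in M B & exists b : 'F_2, x = y + b *: char_vect [set: S])
    (x \in M1 B).
Proof.
apply: (iffP memv_addP) => [[y yM [_ /vlineP[b ->] ->]]|[y yM [b ->]]].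
  by exists y => //; exists b.
by exists y => //; exists (b *: char_vect [set: S]) => //; apply/vlineP; exists b.
Qed.

Lemma epsilon_in_M B : B \in phi E -> epsilon B \in M B.
Proof.
(* The coefficient of e_I is the number of members of B that contain I. *)
move=> phiB; apply/memMP; exists (fun I => #|[set J in B | I \subset J]|%:R).
apply/ffunP => s; rewrite epsilonE sum_char_vectE multE.
rewrite -(chain_sum_above (above_chain phiB (s := s))) natr_sum.
apply: eq_bigr => I; rewrite mem_above => /andP[IB sI]; congr (#|pred_of_set _|%:R).
apply/setP => J; rewrite inE mem_above [RHS]inE; case: (J \in B) => //=.
by case: (boolP (I \subset J)) => [/subsetP->|]; rewrite ?andbF.
Qed.

Lemma half_walk_enc g : walk g -> half_walk (fun s => enc (g s)).
Proof. by move=> wg s; rewrite enc_stepP wg. Qed.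

Lemma enc_epsilon B s : (enc (mult s B))%:~R = epsilon B s.
Proof. by rewrite epsilonE enc_F2. Qed.

(* If a_I are the coefficients of eps(C) on B, then the alternating sums of the
   a_I along the chains of members of B above each vertex form a half-walk with
   the same parity changes as eps(C), so it is the half-walk of C. *)
Lemma epsilon_mult_le B C : B \in phi E -> C \in phi E ->
  epsilon C \in M1 B -> forall s, (mult s C <= mult s B)%N.
Proof.
move=> phiB phiC /memM1P[_ /memMP[a ->] [b epsE]] s.
have epsEs t : epsilon C t = \sum_(I in above B t) a I + b.
  by rewrite epsE ffunE sum_char_vectE ffunE char_vectE inE; congr (_ + _); apply: mulr1.
pose A I : int := (a I : nat)%:Z.
have A01 I : (A I == 0) || (A I == 1) by rewrite /A; have := F2_lt2 (a I); lia.
have AF2 t : (alt_sum A (above B t))%:~R = epsilon C t - b.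
  by rewrite alt_sum_F2 epsEs addrK; apply: eq_bigr => I _; apply: F2_natK.
(* Along an edge the chain gains or loses its smallest member I, so the two alternating sums add up
   to A(I). *)
have wA : half_walk (fun t => alt_sum A (above B t)).
  move=> t; have [[-> ->]|[I [Is -> Imin]]|[I [It -> Imin]]] := phi_step_cases phiB (edge_sigma t).
  - by rewrite alt_sum0.
  - by rewrite (alt_sum_min A Is Imin) subrK A01.
  - by rewrite (alt_sum_min A It Imin) addrC subrK A01.
have encE : enc (mult s C) = alt_sum A (above B s).
  apply: (half_walk_unique (half_walk_enc (phi_walk phiC)) wA) => t.
  (* The constant b enters once for each end of the edge and cancels modulo 2. *)
  by rewrite !rmorphD /= !AF2 !enc_epsilon addrACA -opprD F2_addxx subr0.
rewrite -[mult s C]encK encE; apply: alt_sum_bound A01 _; exact: above_chain.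
Qed.

Local Close Scope ring_scope.

(** * From a closed walk back to an element of phi(V) *)

Section WalkToPhi.

Variables (g : S -> nat) (s0 : S).
Hypothesis walk_g : walk g.

Lemma walk_edge u v : E u v ->
  [|| (g u == 0) && (g v == 0), g u == (g v).+1 | g v == (g u).+1].
Proof.
case/edgeP => ->; first exact: walk_g.
by case/or3P: (walk_g v) => [/andP[-> ->]|->|->]; rewrite ?orbT.
Qed.

Definition comp (d : nat) s : {set S} :=
  [set t | connect (inside [set x | d <= g x]) s t].

Lemma mem_comp d s : s \in comp d s.
Proof. by rewrite inE connect0. Qed.

Lemma comp_level d s : d <= g s -> level g d (comp d s).
Proof.
move=> ds; have ge t : t \in comp d s -> d <= g t.
  rewrite inE => /connectP[p]; elim/last_ind: p => [|p u _]; first by move=> _ ->.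
  by rewrite rcons_path last_rcons => /andP[_ /and3P[_]]; rewrite inE => ? _ ->.
split=> //.
  have toX t : t \in comp d s -> connect (inside (comp d s)) s t.
    rewrite inE => /connectP[p]; elim/last_ind: p t => [|p u IHp] t; first by move=> _ ->; rewrite connect0.
    rewrite rcons_path last_rcons => /andP[pp st] ->; have := IHp _ pp erefl.
    move/connect_trans; apply; apply: connect1.
    have lX : last s p \in comp d s by rewrite inE; apply/connectP; exists p.
    move: (lX); rewrite /= inE => lX'; case/and3P: (st) => _ _ ->.
    by rewrite !inE lX' (connect_trans lX' (connect1 st)).
  apply/connP => x y /toX x0 /toX; apply: connect_trans.
  by rewrite connect_inside_sym.
move=> u v uX vX uv; rewrite ltnNge; apply: contra vX => dv; have du := ge u uX.
by move: uX; rewrite !inE => uX; apply: connect_trans uX (connect1 _); rewrite /= !inE du dv.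
Qed.

Lemma level_comp d X s : level g d X -> s \in X -> X = comp d s.
Proof.
move=> lX sX; apply: (level_unique lX _ sX (mem_comp d s)).
by apply: comp_level; case: lX => _ h _; apply: h.
Qed.

Lemma level_boundary d X u v : level g d X -> u \in X -> v \notin X -> E u v -> g u = d.
Proof.
move=> [_ ge lt] uX vX uv; have := ge u uX; have := lt u v uX vX uv.
by have := walk_edge uv; lia.
Qed.

Lemma level_proper d X : 0 < d -> level g d X -> exists t, t \notin X.
Proof.
move=> d0 [_ ge _]; have [t gt] := walk_zero s0 walk_g; exists t.
by apply/negP => /ge; rewrite gt leqNgt d0.
Qed.

(** At both ends of the arc g equals d, and inside it, at positive height, every step changes
    parity; so the ends are an even number of steps apart. The parity formula serves to verify
    (P_1). *)
Lemma level_arc d X s : 0 < d -> level g d X -> s \in X ->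
  exists a m, [/\ odd m, m < N, X = arc a m &
    forall i, i < m -> odd (g (iter i sigma a)) = odd i (+) odd d].
Proof.
move=> d0 lX sX; have [t tX] := level_proper d0 lX; have [cX ge _] := lX.
have [a [m [m0 mN XE]]] := conn_proper_arc cX sX tX.
have inX i : i < N -> (iter i sigma a \in X) = (i < m) by rewrite XE; apply: mem_arc (ltnW mN).
have [p aE] := sigma_pred a.
have pX : p \notin X.
  rewrite XE; apply/arcP => -[i im pE]; have := iter_sigma_lt a (leq_ltn_trans im mN) (ltn_trans m0 mN).
  by rewrite iterS -pE -aE eqxx.
have gad : g a = d.
  apply: (level_boundary lX _ pX); first by rewrite XE mem_arc_first.
  by rewrite aE edge_sym edge_sigma.
have par i : i < m -> odd (g (iter i sigma a)) = odd i (+) odd d.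
  elim: i => [|i IHi] im; first by rewrite /= gad.
  have im' := ltnW im.
  have gi : 0 < g (iter i sigma a) by apply: leq_trans d0 (ge _ _); rewrite inX // (ltn_trans im').
  have := walk_g (iter i sigma a); rewrite (gtn_eqF gi) /= => gE.
  apply: etrans (_ : ~~ odd (g (iter i sigma a)) = _); last by rewrite (IHi im') addNb.
  by case/orP: gE => /eqP -> /=; rewrite ?negbK.
exists a, m; split=> //.
have m1 : m.-1 < m by rewrite prednK.
have mE : iter m sigma a = sigma (iter m.-1 sigma a) by rewrite -iterS prednK.
have gl : g (iter m.-1 sigma a) = d.
  apply: (level_boundary lX _ _ (edge_sigma _)); first by rewrite inX // (ltn_trans m1).
  by rewrite -mE inX ?ltnn.
by move: (par _ m1); rewrite gl -{2}(prednK m0) /=; case: (odd m.-1); case: (odd d).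
Qed.

(** The ends of X have height d < d', so Y avoids them. Then X - Y has two exits: the end [b] of X
    and the vertex [a] before Y. *)
Lemma level_prec d d' X Y s : 0 < d -> d < d' -> level g d X -> level g d' Y ->
  s \in X -> s \in Y -> prec E Y X.
Proof.
move=> d0 dd' lX lY sX sY; have YX := level_sub (ltnW dd') lX lY sX sY.
have d'0 := ltn_trans d0 dd'; have [t tX] := level_proper d0 lX.
have [t' tY] := level_proper d'0 lY; have [cX geX _] := lX; have [cY geY _] := lY.
have [_ [b [[bX sbX _ _] _]]] := conn_boundary cX sX tX.
have [a [_ [[_ _ aY saY] _]]] := conn_boundary cY sY tY.
have bY : b \notin Y.
  by apply/negP => /geY; rewrite (level_boundary lX bX sbX (edge_sigma b)) leqNgt dd'.
have aX : a \in X.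
  have eda : E (sigma a) a by rewrite edge_sym edge_sigma.
  apply: contraT => aX; have := geY _ saY.
  by rewrite (level_boundary lX (subsetP YX _ saY) aX eda) leqNgt dd'.
apply/andP; split; first by apply/properP; split=> //; exists b.
apply: contraT => cXY; have ba : b = a.
  by apply: (conn_exit_unique cXY); rewrite !inE ?bY ?aY ?bX ?aX ?(negPf sbX) ?saY ?andbF.
by move: sbX; rewrite ba (subsetP YX _ saY).
Qed.

(** The shift [d.+1] lets the level run from 1 to g s; level 0 is the whole cycle and is left
    out. *)
Definition walk_family : {set {set S}} :=
  [set X | [exists s, exists d : 'I_(g s), X == comp d.+1 s]].

Lemma walk_familyP X :
  reflect (exists d s, [/\ 0 < d, level g d X & s \in X]) (X \in walk_family).
Proof.
rewrite inE; apply: (iffP existsP) => [[s /existsP[d /eqP->]]|[d [s [d0 lX sX]]]].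
  by exists d.+1, s; rewrite mem_comp; split=> //; apply: comp_level.
have ds : d.-1 < g s by rewrite prednK //; case: lX => _ ge _; apply: ge.
by exists s; apply/existsP; exists (Ordinal ds); rewrite /= prednK // -(level_comp lX sX).
Qed.

(** The components through s at levels 1, ..., g s are distinct, being strictly nested by
    [level_prec]. *)
Lemma walk_family_mult s : mult s walk_family = g s.
Proof.
rewrite multE (_ : above _ s = [set comp d.+1 s | d : 'I_(g s)]).
  rewrite card_imset ?card_ord // => d d' eqc; apply: val_inj => /=.
  have lt (i j : 'I_(g s)) : comp i.+1 s = comp j.+1 s -> ~~ (i < j).
    move=> eqij; apply/negP => ij.
    have := level_prec (ltn0Sn i) (ij : i.+1 < j.+1) (comp_level (ltn_ord i))
      (comp_level (ltn_ord j)) (mem_comp _ s) (mem_comp _ s).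
    by rewrite eqij => /andP[]; rewrite properxx.
  by have := lt _ _ eqc; have := lt _ _ (esym eqc); case: ltngtP.
apply/setP => X; rewrite mem_above; apply/andP/imsetP.
  move=> [/walk_familyP[d [t [d0 lX _]]] sX].
  have ds : d.-1 < g s by rewrite prednK //; case: lX => _ ge _; apply: ge.
  by exists (Ordinal ds) => //=; rewrite prednK // -(level_comp lX sX).
move=> [d _ ->]; rewrite mem_comp; split=> //; apply/walk_familyP.
by exists d.+1, s; rewrite mem_comp; split=> //; apply: comp_level.
Qed.

Lemma walk_family_phi : walk_family \in phi E.
Proof.
rewrite inE; apply/and3P; split.
- apply/subsetP => X /walk_familyP[d [s [d0 lX sX]]].
  by have [a [m [om mN -> _]]] := level_arc d0 lX sX; apply: odd_intervals_arc.
- apply/forall_inP => X /walk_familyP[d [s [d0 lX sX]]].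
  apply/forall_inP => Y /walk_familyP[d' [t [d'0 lY tY]]].
  wlog dd' : d d' X Y s t d0 d'0 lX lY sX tY / d <= d'.
    move=> h; case: (leqP d d') => dd'; first exact: (h d d' X Y s t).
    have := h d' d Y X t s d'0 d0 lY lX tY sX (ltnW dd').
    by rewrite eq_sym /spade disjoint_sym setUC [prec E Y X || _]orbC.
  case: (boolP [disjoint X & Y]) => [dXY|/pred0Pn[u /andP[uX uY]]].
    suff -> : spade E X Y by rewrite orbT.
    (* An edge from X into Y would drop below d, while Y stays at height at least d' >= d. *)
    rewrite /spade dXY; apply: (no_edge_disconnected sX tY dXY) => u v uX vY.
    apply/negP => uv; have [_ _ lt] := lX; have [_ ge _] := lY.
    have := lt u v uX; rewrite (disjointFl dXY vY) => /(_ isT uv).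
    by rewrite ltnNge (leq_trans dd' (ge v vY)).
  move: dd'; rewrite leq_eqVlt => /orP[/eqP dd'|dd'].
    by rewrite -dd' in lY; rewrite (level_unique lX lY uX uY) eqxx.
  by rewrite (level_prec d0 dd' lX lY uX uY) !orbT.
- apply/forall_inP => X /walk_familyP[d [s [d0 lX sX]]]; apply/existsP.
  (* The family for (P_1) consists of the components one level higher inside X. A vertex of X^ev has
     odd position, so its height differs in parity from d and exceeds d. *)
  pose C := [set comp d.+1 t | t in [set t in X | d < g t]].
  have CP Y : Y \in C -> exists t, [/\ t \in X, t \in Y & level g d.+1 Y].
    move=> /imsetP[t]; rewrite inE => /andP[tX dt] ->; exists t.
    by rewrite mem_comp; split=> //; apply: comp_level.
  exists C; apply/and4P; split.
  + by apply/subsetP => Y /CP[t [_ tY lY]]; apply/walk_familyP; exists d.+1, t.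
  + apply/trivIsetP => Y Z /CP[y [_ yY lY]] /CP[z [_ zZ lZ]].
    apply: contraR => /pred0Pn[u /andP[uY uZ]].
    by rewrite (level_unique lY lZ uY uZ).
  + by apply/forall_inP => Y /CP[t [tX tY lY]]; apply: (level_prec d0 (ltnSn d) lX lY tX tY).
  + apply/subsetP => u uev; have [a [m [om mN XE par]]] := level_arc d0 lX sX.
    have uX : u \in X by move: uev; rewrite inE => /andP[].
    have du : d < g u.
      have [_ ge _] := lX; rewrite ltn_neqAle ge // andbT.
      move: uX uev; rewrite XE => /arcP[i im ->] /(ev_arc_odd mN im) oi.
      apply/eqP => dE; have := par i im; rewrite -dE oi.
      by case: (odd d).
    by apply/bigcupP; exists (comp d.+1 u); [apply: imset_f; rewrite inE uX|exact: mem_comp].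
Qed.

End WalkToPhi.

(** * Surjectivity of [epsilon] modulo e_S *)

Local Open Scope ring_scope.

(** With c in {0, 1} lifting the edge sums of x, solve h(s) + h(sigma s) = c(s). As N is odd, one
    turn around the cycle expresses 2h(s) as an alternating sum of c. *)
Lemma half_walk_exists (x : S -> 'F_2) : exists h : S -> int,
  half_walk h /\ forall s, (h s + h (sigma s))%:~R = x s + x (sigma s).
Proof.
pose c s : int := (x s != x (sigma s))%:Z.
have cF2 s : (c s)%:~R = x s + x (sigma s) :> 'F_2.
  rewrite /c; case: eqP => [->|/eqP xs]; first by rewrite F2_addxx.
  apply/esym/eqP; move: xs; rewrite -subr_eq0 F2_opp.
  by case: (x s + x (sigma s)) => [[|[|]]].
pose D n s := \sum_(i < n) (-1) ^+ i * c (iter i sigma s).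
have DS n s : D n.+1 s = D n s + (-1) ^+ n * c (iter n sigma s) by exact: big_ord_recr.
have Dstep n s : D n s + D n (sigma s) = c s - (-1) ^+ n * c (iter n sigma s).
  elim: n => [|n IHn]; first by rewrite /D !big_ord0 expr0 mul1r addr0 subrr.
  rewrite !DS addrACA IHn -iterSr exprS mulN1r mulNr opprK.
  by rewrite addrA subrK.
have DF2 n s : (D n s)%:~R = x s + x (iter n sigma s) :> 'F_2.
  elim: n => [|n IHn]; first by rewrite /D big_ord0 /= F2_addxx.
  rewrite DS rmorphD rmorphM rmorphXn /= rmorphN rmorph1 F2_opp expr1n mul1r IHn cF2.
  by rewrite addrA -(addrA (x s)) F2_addxx addr0.
(* Modulo 2 the sum telescopes to x s + x s = 0, so halving it is exact. *)
have even s : (2 %| D N s)%Z.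
  have /eqP := DF2 N s; rewrite iter_sigma_period F2_addxx F2_intE dvdzE dvdn2.
  by case: (odd _).
pose h s := (D N s %/ 2)%Z.
have hE s : h s + h (sigma s) = c s.
  have := Dstep N s; rewrite iter_sigma_period -signr_odd N_odd expr1 mulN1r opprK.
  by rewrite -(divzK (even s)) -(divzK (even (sigma s))) -/(h s) -/(h (sigma s)); lia.
exists h; split=> s; rewrite hE; last exact: cF2.
by rewrite /c; case: (_ != _).
Qed.

(** Build B from the half-walk of x. Then x and eps(B) have equal sums along all edges, so their
    difference is constant around the cycle, a multiple of e_S. *)
Lemma epsilon_onto (s0 : S) (x : FSpace S) : exists B, exists b : bool,
  B \in phi E /\ x = epsilon B + b%:R *: char_vect [set: S].
Proof.
have [h [wh hx]] := half_walk_exists x.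
have wg : walk (fun s => dec (h s)).
  by move=> s; rewrite -enc_stepP !decK; apply: wh.
have := walk_family_phi s0 wg; have := walk_family_mult s0 wg.
set B := walk_family _ => multB phiB.
have epsB s : epsilon B s = (h s)%:~R by rewrite -enc_epsilon multB decK.
pose d s : 'F_2 := x s - epsilon B s.
have dS s : d (sigma s) = d s.
  have := hx s; rewrite rmorphD /= -!epsB => e.
  apply/eqP; rewrite -subr_eq0 /d !F2_opp addrACA.
  by rewrite [X in X + _]addrC [X in _ + X]addrC e F2_addxx.
have dC s : d s = d s0.
  by have [i ->] := sigma_trans s0 s; elim: i => //= i <-; apply: dS.
exists B, (d s0 != 0); split=> //; apply/ffunP => s.
rewrite !ffunE char_vectE inE; have := dC s; rewrite {1}/d => /eqP.
rewrite subr_eq addrC => /eqP ->; congr (_ + _).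
by apply/esym; apply: etrans (mulr1 _) _; case: (d s0) => [[|[|]]] //= ?; apply: val_inj.
Qed.

(** * Injectivity for both kinds of subspaces *)

Lemma epsilon_antisym B C : B \in phi E -> C \in phi E ->
  epsilon C \in M1 B -> epsilon B \in M1 C -> B = C.
Proof.
move=> phiB phiC CB BC; apply: mult_inj => // s; apply/eqP.
by rewrite eqn_leq !epsilon_mult_le.
Qed.

Definition ext_space (b : bool) B : {vspace FSpace S} := if b then M1 B else M B.
Definition ext_epsilon (b : bool) B : FSpace S := epsilon B + b%:R *: char_vect [set: S].

Lemma subv_M1 b B : (ext_space b B <= M1 B)%VS.
Proof. by case: b => //; apply: addvSl. Qed.

Lemma ext_epsilon_in b B : B \in phi E -> ext_epsilon b B \in ext_space b B.
Proof.
move=> phiB; have epsB := epsilon_in_M phiB.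
case: b; rewrite /ext_epsilon /ext_space; last by rewrite scale0r addr0.
by apply/memM1P; exists (epsilon B) => //; exists 1.
Qed.

Lemma epsilon_in_M1 b B C : B \in phi E ->
  (ext_epsilon b B \in M1 C) = (epsilon B \in M1 C).
Proof.
move=> phiB; apply: rpredDr; apply: memvZ; apply/memM1P.
by exists 0; [apply: mem0v | exists 1; rewrite add0r scale1r].
Qed.

(** All elements of M_B vanish at a vertex of multiplicity 0, where e_S takes the value 1. *)
Lemma char_setT_notin_M (s0 : S) B : B \in phi E -> char_vect [set: S] \notin M B.
Proof.
move=> phiB; have [t tB] := walk_zero s0 (phi_walk phiB).
apply/negP => /memMP[a] /ffunP/(_ t).
rewrite sum_char_vectE (_ : above B t = set0); last by apply/eqP; rewrite -cards_eq0 -multE tB.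
by rewrite big_set0 char_vectE inE => /eqP.
Qed.

(** Whether e_S belongs to the space determines [b]. Each space contains the extended epsilon of the
    other, so [epsilon_antisym] applies. *)
Lemma ext_space_inj (s0 : S) b c B C : B \in phi E -> C \in phi E ->
  ext_space b B = ext_space c C -> b = c /\ B = C.
Proof.
move=> phiB phiC eqM.
have ST (d : bool) D : D \in phi E -> (char_vect [set: S] \in ext_space d D) = d.
  move=> phiD; case: d => /=; last by rewrite (negPf (char_setT_notin_M s0 phiD)).
  by apply/memM1P; exists 0; [apply: mem0v | exists 1; rewrite add0r scale1r].
split; first by rewrite -(ST b B phiB) eqM ST.
apply: epsilon_antisym => //.
- rewrite -(epsilon_in_M1 c) //; apply: (subvP (subv_M1 b B)).
  by rewrite eqM ext_epsilon_in.
- rewrite -(epsilon_in_M1 b) //; apply: (subvP (subv_M1 c C)).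
  by rewrite -eqM ext_epsilon_in.
Qed.

(** eps(B) and eps(C) differ by a multiple of e_S, so each lies in [M1] of the other; any single
    vertex then tells [b] from [c]. *)
Lemma ext_epsilon_inj (s0 : S) b c B C : B \in phi E -> C \in phi E ->
  ext_epsilon b B = ext_epsilon c C -> b = c /\ B = C.
Proof.
move=> phiB phiC eqe.
have M_M1 D : D \in phi E -> epsilon D \in M1 D.
  by move=> phiD; apply: (subvP (subv_M1 false D)); apply: epsilon_in_M.
have CB : epsilon C \in M1 B.
  rewrite -(epsilon_in_M1 c B phiC) -eqe (epsilon_in_M1 b B phiB); exact: M_M1.
have BC : epsilon B \in M1 C.
  rewrite -(epsilon_in_M1 b C phiB) eqe (epsilon_in_M1 c C phiC); exact: M_M1.
have {CB BC M_M1} BC := epsilon_antisym phiB phiC CB BC.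
split; last exact: BC.
move: eqe; rewrite BC => /addrI/ffunP/(_ s0).
rewrite !ffunE char_vectE inE => e.
have : (b%:R : 'F_2) * 1 = c%:R * 1 := e.
by rewrite !mulr1; clear; case: b c => [] [].
Qed.

(** * The order on phi(V) and on the subspaces *)

Lemma le_phi_mult B' B s : le_phi E B' B -> (mult s B' <= mult s B)%N.
Proof.
move=> /and3P[_ _ /connectP[p]]; elim: p B' => [|C p IHp] B' /=; first by move=> _ ->.
move=> /andP[/and3P[phiB' phiC B'C] pp] lp; apply: leq_trans (IHp C pp lp).
by apply: epsilon_mult_le => //; apply: (subvP (subv_M1 false C)).
Qed.

Lemma le_phi_anti B C : le_phi E B C -> le_phi E C B -> B = C.
Proof.
move=> BC CB; have /and3P[phiB phiC _] := BC.
by apply: mult_inj => // s; apply/eqP; rewrite eqn_leq !le_phi_mult.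
Qed.

Lemma le_phi_refl B : B \in phi E -> le_phi E B B.
Proof. by move=> phiB; rewrite /le_phi phiB connect0. Qed.

Lemma le_phi_trans C B D : le_phi E B C -> le_phi E C D -> le_phi E B D.
Proof.
move=> /and3P[phiB _ BC] /and3P[_ phiD CD]; rewrite /le_phi phiB phiD.
exact: connect_trans BC CD.
Qed.

Lemma FtildeP (X : Ftilde E) : exists b, exists2 B, B \in phi E & val X = ext_space b B.
Proof.
case: X => X /= /orP[] /exists_inP[B phiB /eqP ->].
  by exists false, B.
by exists true, B.
Qed.

Lemma ext_space_Ftilde b B : B \in phi E ->
  calF E (ext_space b B) || calF1 E (ext_space b B).
Proof.
by move=> phiB; case: b; apply/orP; [right|left]; apply/exists_inP; exists B => /=.
Qed.

(** The three clauses of the relation are the pairs of flags in which b' implies b. *)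
Lemma le_tildeP (X' X : Ftilde E) :
  reflect (exists b' b B' B, [/\ b' ==> b, le_phi E B' B,
             val X' = ext_space b' B' & val X = ext_space b B])
    (le_tilde X' X).
Proof.
apply: (iffP existsP) => [[B /existsP[B' /andP[le /or3P[]/andP[/eqP-> /eqP->]]]]|].
- by exists false, false, B', B.
- by exists true, true, B', B.
- by exists false, true, B', B.
move=> [b' [b [B' [B [bb le -> ->]]]]]; exists B; apply/existsP; exists B'.
by rewrite le /=; case: b' b bb => [] [] //= _; rewrite !eqxx ?orbT.
Qed.

(** Choose any pair (b, B) that represents X; by [ext_space_inj] it is the only one. *)
Lemma epsilon_tilde_exists (s0 : S) : exists et : Ftilde E -> FSpace S,
  forall (X : Ftilde E) b B, B \in phi E -> val X = ext_space b B -> et X = ext_epsilon b B.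
Proof.
pose ok (X : Ftilde E) (p : bool * {set {set S}}) := (p.2 \in phi E) && (val X == ext_space p.1 p.2).
have okE (X : Ftilde E) : exists p, ok X p.
  by have [b [B phiB XE]] := FtildeP X; exists (b, B); rewrite /ok phiB XE eqxx.
exists (fun X : Ftilde E => ext_epsilon (xchoose (okE X)).1 (xchoose (okE X)).2) => X b B phiB XE.
case/andP: (xchooseP (okE X)); case: (xchoose _) => c C /= phiC /eqP; rewrite XE.
by move=> /(ext_space_inj s0 phiB phiC)[-> ->].
Qed.

Lemma tilde_bijective_and_order (s0 : S) :
  exists et : Ftilde E -> FSpace S,
    is_epsilon_tilde et /\
    (forall X : Ftilde E, et X \in val X) /\
    bijective et /\
    (reflexive (@le_tilde S E) /\ antisymmetric (@le_tilde S E) /\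
     transitive (@le_tilde S E)).
Proof.
have [et etE] := epsilon_tilde_exists s0; exists et; split; last split; last split; last split; last split.
- move=> X B phiB; split=> XE.
    by rewrite (etE X false B) // /ext_epsilon scale0r addr0.
  by rewrite (etE X true B) // /ext_epsilon scale1r.
- move=> X; have [b [B phiB XE]] := FtildeP X.
  by rewrite (etE X b B) // XE ext_epsilon_in.
- have onto (x : FSpace S) : exists p : bool * {set {set S}}, (p.2 \in phi E) && (ext_epsilon p.1 p.2 == x).
    by have [B [b [phiB ->]]] := epsilon_onto s0 x; exists (b, B); rewrite phiB eqxx.
  pose p x := xchoose (onto x); have pP x := andP (xchooseP (onto x)).
  pose inv (x : FSpace S) : Ftilde E :=
    exist (fun W => calF E W || calF1 E W) _ (ext_space_Ftilde (p x).1 (proj1 (pP x))).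
  have etK x : et (inv x) = x.
    by rewrite (etE (inv x) (p x).1 (p x).2 (proj1 (pP x))) //; apply/eqP; apply: (proj2 (pP x)).
  exists inv => // X; apply: val_inj.
  have [b [B phiB XE]] := FtildeP X; have [c [C phiC YE]] := FtildeP (inv (et X)).
  rewrite XE YE; have := etK (et X); rewrite (etE _ _ _ phiC YE) (etE _ _ _ phiB XE).
  by move=> /(ext_epsilon_inj s0 phiC phiB)[-> ->].
- move=> X; have [b [B phiB XE]] := FtildeP X; apply/le_tildeP.
  by exists b, b, B, B; rewrite implybb; split=> //; apply: le_phi_refl.
- move=> X Y /andP[/le_tildeP[b [c [B [C [bc BC XE YE]]]]] /le_tildeP[c' [b' [C' [B' [cb CB YE' XE']]]]]].
  apply: val_inj; rewrite XE YE.
  have /and3P[phiB phiC _] := BC; have /and3P[phiC' phiB' _] := CB.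
  have [bE BE] := ext_space_inj s0 phiB phiB' (etrans (esym XE) XE').
  have [cE CE] := ext_space_inj s0 phiC phiC' (etrans (esym YE) YE').
  rewrite -BE -CE in CB; rewrite -bE -cE in cb.
  by rewrite (le_phi_anti BC CB); case: b c bc cb {XE YE bE cE} => [] [].
- move=> Y X Z /le_tildeP[a [b [A [B [ab AB XE YE]]]]] /le_tildeP[b' [c [B' [C [bc BC YE' ZE]]]]].
  apply/le_tildeP; exists a, c, A, C.
  have /and3P[_ phiB _] := AB; have /and3P[phiB' _ _] := BC.
  have [bE BE] := ext_space_inj s0 phiB phiB' (etrans (esym YE) YE').
  rewrite -BE in BC; rewrite -bE in bc; split=> //; first by apply/implyP => /(implyP ab)/(implyP bc).
  exact: le_phi_trans AB BC.
Qed.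

End CycleGraph.

(** * The rotation carried over from the standard N-cycle *)

Theorem mainTheorem4 (N : nat) (hN3 : (3 <= N)%N) (hNodd : odd N)
    (S : finType) (E : rel S) (hE : is_cycle E N) :
  exists et : Ftilde E -> FSpace S,
    is_epsilon_tilde et /\
    (forall X : Ftilde E, et X \in val X) /\
    bijective et /\
    (reflexive (@le_tilde S E) /\ antisymmetric (@le_tilde S E) /\
     transitive (@le_tilde S E)).
Proof.
have N0 : 0 < N by apply: leq_trans hN3.
case/existsP: hE => f /and3P[/injectiveP fI /eqP fT /forallP fE].
have {}fE i j : E (f i) (f j) = cycle_graph i j by have /forallP/(_ j)/eqP := fE i.
have fex s : exists i, f i == s.
  have : s \in [set: S] by rewrite inE.  by rewrite -fT => /imsetP[i _ ->]; exists i.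
pose r s := xchoose (fex s); have rK s : f (r s) = s by apply/eqP/(xchooseP (fex s)).
have fK i : r (f i) = i by apply: fI; rewrite rK.
pose sigma s := f (ordS (r s)).
have iterE i s : iter i sigma s = f (iter i (@ordS N) (r s)).
  by elim: i => [|i IHi] /=; rewrite ?rK // IHi /sigma fK.
have valE i (k : 'I_N) : val (iter i (@ordS N) k) = (k + i) %% N.
  elim: i => [|i IHi] /=; first by rewrite addn0 modn_small.
  by rewrite IHi -addn1 modnDml addn1 addnS.
apply: (@tilde_bijective_and_order S E N sigma hN3 hNodd _ _ _ _ (f (Ordinal N0))).
- by move=> s t; rewrite -{1}[s]rK -{1}[t]rK fE /cycle_graph /sigma -[s in RHS]rK -[t in RHS]rK !fK !(inj_eq fI).
- by move=> s t /fI /ordS_inj rst; rewrite -[s]rK rst rK.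
(* Go on from s to index 0, then to t; this keeps the number of steps natural when r t < r s. *)
- move=> s t; exists (r t + (N - r s)); rewrite iterE -[LHS]rK; congr (f _); apply: val_inj.
  rewrite valE addnCA subnKC ?(ltnW (ltn_ord _)) // modnDr modn_small //.
- by move=> i j s; rewrite !iterE (inj_eq fI) -val_eqE !valE eqn_modDl.
Qed.
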